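(* Let $S$ be a straight left I-order in an inverse semigroup $Q$ and let $T$ be a subsemigroup of an inverse semigroup $P$. Suppose that $\phi:S\to T$ is a semigroup morphism. Then $\phi$ lifts to a (unique) morphism $\overline{\phi}:Q\to P$ if and only if for all $a,b,c\in S$: (i) $(a,b)\in\mathcal{R}^Q_S\Rightarrow (a\phi,b\phi)\in\mathcal{R}^P_T$; (ii) $(a,b,c)\in\mathcal{T}^Q_S\Rightarrow (a\phi,b\phi,c\phi)\in\mathcal{T}^P_T$. If (i) and (ii) hold and $S\phi$ is a left I-order in $P$, then $\overline{\phi}:Q\to P$ is onto.
   Context: Maps are written on the right. For $a$ in an inverse semigroup, $a^{-1}$ is its inverse in the sense of inverse semigroup theory. A subsemigroup $S$ of an inverse semigroup $Q$ is a left I-order in $Q$ if every $q\in Q$ can be written as $q=a^{-1}b$ with $a,b\in S$; it is straight in $Q$ if every $q\in Q$ can be written as $q=a^{-1}b$ with $a,b\in S$ and $a\,\mathcal{R}\,b$ in $Q$ (Green's relation). For a subsemigroup $S$ of an inverse semigroup $Q$: $\mathcal{R}^Q_S=\mathcal{R}^Q\cap(S\times S)$, where $\mathcal{R}^Q$ is Green's relation $\mathcal{R}$ on $Q$; and $\mathcal{T}^Q_S$ is the ternary relation on $S$ given by $(a,b,c)\in\mathcal{T}^Q_S$ if and only if $ab^{-1}Q\subseteq c^{-1}Q$ (inverses taken in $Q$). Similarly $\mathcal{R}^P_T$, $\mathcal{T}^P_T$ for $T\subseteq P$. A morphism $\phi:S\to P$ lifts to a morphism $\overline\phi:Q\to P$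 if $\overline\phi|_S=\phi$ (here $\phi:S\to T$ is regarded as a map into $P$). *)

(* Defs.v *)
From HB Require Import structures.
From mathcomp Require Import all_boot.
From mathcomp Require Import boolp classical_sets.

Set Implicit Arguments.
Unset Strict Implicit.
Unset Printing Implicit Defensive.

Local Open Scope classical_set_scope.
Local Open Scope group_scope.

Definition is_inverse (G : semigroupType) (a x : G) : Prop :=
  a * x * a = a /\ x * a * x = x.

HB.mixin Record Semigroup_isInverseSemigroup G of Semigroup G := {
  sginv : G -> G;
  sginvP : forall a : G, is_inverse a (sginv a);
  sginv_unique : forall a x : G, is_inverse a x -> x = sginv a
}.

#[short(type="inverseSemigroupType")]
HB.structure Definition InverseSemigroup :=
  {G of Semigroup_isInverseSemigroup G & Semigroup G}.

Record subsemigroup (G : semigroupType) := Subsemigroup {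
  subsemigroup_set : set G;
  subsemigroupM : forall x y : G,
    subsemigroup_set x -> subsemigroup_set y -> subsemigroup_set (x * y)
}.

(* A separate constant, so that the semigroup structure below is attached to
   [subsemigroup_sort] and not to every sigma type. *)
Definition subsemigroup_sort (G : semigroupType) (S : subsemigroup G) : Type :=
  set_type (subsemigroup_set S).
Coercion subsemigroup_sort : subsemigroup >-> Sortclass.

Section SubsemigroupType.
Variables (G : semigroupType) (S : subsemigroup G).

Fact subsemigroup_mulg_closed : mulg_closed (mem (subsemigroup_set S)).
Proof.
by move=> x y /set_mem Sx /set_mem Sy; apply/mem_set/subsemigroupM.
Qed.

HB.instance Definition _ := SubChoice.on (subsemigroup_sort S).
HB.instance Definition _ :=
  SubChoice_isSubSemigroup.Build G _ (subsemigroup_sort S)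
    subsemigroup_mulg_closed.
End SubsemigroupType.

(* The image of a morphism into [T], as a subsemigroup of the ambient [P]. *)
Section Image.
Variables (S P : semigroupType) (T : subsemigroup P).
Variable phi : {multiplicative S -> T}.

Fact imageM (x y : P) :
  range (fun s => val (phi s)) x -> range (fun s => val (phi s)) y ->
  range (fun s => val (phi s)) (x * y).
Proof.
by move=> [s _ <-] [t _ <-]; exists (s * t) => //; rewrite gmulfM valM.
Qed.

Definition image_subsemigroup : subsemigroup P := Subsemigroup imageM.
End Image.

Section Green.
Variable Q : semigroupType.

Definition right_mul_set (a : Q) : set Q := [set a * q | q in [set: Q]].

Definition principal_right_ideal (a : Q) : set Q := a |` right_mul_set a.

Definition greenR (a b : Q) : Prop :=
  principal_right_ideal a = principal_right_ideal b.
End Green.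

Section Orders.
Variables (Q : inverseSemigroupType) (S : subsemigroup Q).

Definition left_I_order : Prop :=
  forall q : Q, exists a b : S, q = sginv (val a) * val b.

Definition straight : Prop :=
  forall q : Q, exists a b : S,
    q = sginv (val a) * val b /\ greenR (val a) (val b).

Definition relR (a b : S) : Prop := greenR (val a) (val b).

Definition relT (a b c : S) : Prop :=
  right_mul_set (val a * sginv (val b)) `<=` right_mul_set (sginv (val c)).
End Orders.

Definition lifts (Q P : semigroupType) (S : subsemigroup Q)
    (T : subsemigroup P) (phi : {multiplicative S -> T})
    (f : {multiplicative Q -> P}) : Prop :=
  forall s : S, f (val s) = val (phi s).

(* Main.v *)
Require Import Defs.
From HB Require Import structures.
From mathcomp Require Import all_boot.
From mathcomp Require Import boolp classical_sets.

Set Implicit Arguments.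
Unset Strict Implicit.
Unset Printing Implicit Defensive.

(** Write [a^*] for the inverse of [a].  A lift [f] of [phi] has to preserve
    inverses, so that [f (a^* * b) = (phi a)^* * phi b]; since every element of
    [Q] is such a quotient [a^* * b], this gives uniqueness, and the range of
    [f] contains every quotient of elements of the image of [phi], which gives
    surjectivity.  When the conditions hold, the same formula defines [f], on a
    chosen representation [a^* * b] with [a R b].

    The crux is that products and equalities of quotients in [Q] are governed by
    equations [b * c^* = x^* * y] with [x R y], where [b], [c], [x], [y] lie in
    [S]: straightness says that [b] and [c] always admit such [x] and [y].  In
    any inverse semigroup, when [x R y], such an equation is equivalent to the
    conjunction of [x * b = y * c], [y R y * c] and
    [b * c^* * Q `<=` x^* * Q] ([right_quotient_common_multiple] and
    [right_quotientI]).  A morphism on [S] preserves the first of these, and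
    conditions (i) and (ii) are what it takes to preserve the other two.  Hence
    [phi] carries the whole equation from [Q] to [P]
    ([lift_right_quotient]).

    Both properties of [f] follow.  For multiplicativity,
    [a^* * b * (c^* * d) = a^* * x^* * y * d = (x * a)^* * (y * d)], where
    [x * a R y * d].  For independence of the representation, take [x R y] with
    [a * c^* = x^* * y]; then an equality [a^* * b = c^* * d] amounts to
    [x * a = y * c] and [x * b = y * d], together with [a * Q `<=` x^* * Q] and
    [c * Q `<=` y^* * Q], and these are again preserved
    ([left_quotient_eq_witness] and [left_quotient_eqI]). *)

Local Open Scope classical_set_scope.
Local Open Scope group_scope.

Local Notation "a ^*" := (sginv a) : group_scope.

(** * Inverse semigroups *)

Section InverseSemigroupTheory.
Variable Q : inverseSemigroupType.
Implicit Types a b c d e f x y : Q.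

Lemma mulgVg a : a * a^* * a = a.
Proof. by have [] := sginvP a. Qed.

Lemma mulVgV a : a^* * a * a^* = a^*.
Proof. by have [] := sginvP a. Qed.

Lemma sginvK a : a^*^* = a.
Proof. by symmetry; apply: sginv_unique; split; rewrite (mulgVg, mulVgV). Qed.

(** The inverse [x] of [e * f] equals [f * x * e], which is idempotent and hence
    its own inverse; therefore [e * f] is idempotent too. *)
Lemma idempotentM e f : e * e = e -> f * f = f -> e * f * (e * f) = e * f.
Proof.
move=> ee ff; set x := (e * f)^*.
have fxe : f * x * e = x.
  apply: sginv_unique; split.
    by rewrite -[RHS]mulgVg !mulgA -(mulgA e f f) ff -(mulgA _ e e) ee.
  rewrite !mulgA -(mulgA _ e e) ee -(mulgA _ f f) ff.
  by rewrite -[in RHS](mulVgV (e * f) : x * _ * x = x) !mulgA.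
have xx : x * x = x.
  rewrite -[X in X * _]fxe -[X in _ * X]fxe -[RHS]fxe.
  by rewrite -[X in _ = f * X * e]mulVgV !mulgA.
have xV : x^* = x by symmetry; apply: sginv_unique; split; rewrite !xx.
by move: xx; rewrite -xV sginvK.
Qed.

Lemma idempotentC e f : e * e = e -> f * f = f -> e * f = f * e.
Proof.
move=> ee ff; have efI := idempotentM ee ff; have feI := idempotentM ff ee.
have -> : e * f = (e * f)^* by apply: sginv_unique; split; rewrite !efI.
symmetry; apply: sginv_unique; split.
  by rewrite !mulgA -(mulgA _ f f) ff -(mulgA _ e e) ee -[RHS]efI !mulgA.
by rewrite !mulgA -(mulgA _ e e) ee -(mulgA _ f f) ff -[RHS]feI !mulgA.
Qed.

Lemma idempotent_mulVg a : a^* * a * (a^* * a) = a^* * a.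
Proof. by rewrite mulgA mulVgV. Qed.

Lemma idempotent_mulgV a : a * a^* * (a * a^*) = a * a^*.
Proof. by rewrite mulgA mulgVg. Qed.

Lemma sginvM a b : (a * b)^* = b^* * a^*.
Proof.
symmetry; apply: sginv_unique; split.
  rewrite -[RHS](congr2 mul (mulgVg a) (mulgVg b)) !mulgA.
  congr (_ * b); rewrite -!mulgA; congr (a * _); rewrite !mulgA.
  by rewrite -(mulgA _ a^* a) (idempotentC (idempotent_mulgV b)
    (idempotent_mulVg a)) !mulgA.
rewrite -[RHS](congr2 mul (mulVgV b) (mulVgV a)) !mulgA.
congr (_ * a^*); rewrite -!mulgA; congr (b^* * _); rewrite !mulgA.
by rewrite -(mulgA _ b b^*) (idempotentC (idempotent_mulVg a)
  (idempotent_mulgV b)) !mulgA.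
Qed.

Lemma right_mul_set_subE a b :
  (right_mul_set a `<=` right_mul_set b) <-> b * b^* * a = a.
Proof.
split=> [sab | <-]; last first.
  by move=> _ [q _ <-]; exists (b^* * a * q) => //; rewrite !mulgA.
have [|q _ qE] := sab a; first by exists (a^* * a); rewrite // mulgA mulgVg.
by rewrite -qE mulgA mulgVg.
Qed.

Lemma principal_right_idealE a : principal_right_ideal a = right_mul_set a.
Proof.
apply: setUidr => _ ->.
by exists (a^* * a); rewrite // mulgA mulgVg.
Qed.

Lemma greenRE a b : greenR a b <-> a * a^* = b * b^*.
Proof.
rewrite /greenR !principal_right_idealE; split=> [ab | ab]; last first.
  by apply/seteqP; split; apply/right_mul_set_subE; rewrite -(ab, esym ab) mulgVg.
have /right_mul_set_subE ba : right_mul_set a `<=` right_mul_set b by rewrite ab.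
have /right_mul_set_subE ab' : right_mul_set b `<=` right_mul_set a by rewrite ab.
rewrite -{1}ba -[X in _ = X * _]ab' -2![LHS]mulgA [LHS]mulgA -2![RHS]mulgA [RHS]mulgA.
by apply: idempotentC; apply: idempotent_mulgV.
Qed.

(** * Common multiples and quotients *)

(** The domain idempotent [x^* * x] is [b * c^* * c * b^*], so [x] cuts [b] down
    to the part on which [b^* * b] and [c^* * c] agree; this is why
    [x * b = y * c] holds on the nose. *)
Lemma right_quotient_common_multiple b c x y :
  x * x^* = y * y^* -> b * c^* = x^* * y ->
  [/\ x * b = y * c, y * y^* = y * c * (y * c)^*
    & x^* * x * (b * c^*) = b * c^*].
Proof.
move=> xRy bcE.
have cbE : c * b^* = y^* * x by rewrite -[c]sginvK -sginvM bcE sginvM sginvK.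
have xVx : x^* * x = b * c^* * (c * b^*).
  by rewrite bcE cbE !mulgA -(mulgA _ y) -xRy mulgA mulVgV.
have xbcV : x * b * c^* = y by rewrite -mulgA bcE mulgA xRy mulgVg.
have xbE : x * b = y * c.
  rewrite -[in LHS](mulgVg x) -(mulgA x) xVx -xbcV -!mulgA; congr (x * _).
  rewrite !mulgA -(mulgA _ b^*) -(mulgA b) -(mulgA b).
  by rewrite (idempotentC (idempotent_mulVg c) (idempotent_mulVg b)) !mulgA mulgVg.
split=> //; last by rewrite bcE !mulgA mulVgV.
by rewrite sginvM mulgA -xbE xbcV.
Qed.

Lemma right_quotientI b c x y :
  x * b = y * c -> y * y^* = y * c * (y * c)^* ->
  x^* * x * (b * c^*) = b * c^* -> b * c^* = x^* * y.
Proof.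
move=> xbE yRyc <-; rewrite -mulgA (mulgA x) xbE; congr (_ * _).
rewrite -[in RHS](mulgVg y) yRyc sginvM !mulgA -!mulgA.
rewrite (mulgA c) (idempotentC (idempotent_mulgV c) (idempotent_mulVg y)).
by rewrite !mulgA mulgVg.
Qed.

Lemma left_quotient_mulV a b :
  a * a^* = b * b^* -> a^* * b * (a^* * b)^* = a^* * a.
Proof.
by move=> aRb; rewrite sginvM sginvK mulgA -(mulgA _ b) -aRb mulgA !mulVgV.
Qed.

(** Equal quotients [a^* * b] and [c^* * d] have the same idempotent [q * q^*], so
    [a^* * a = c^* * c].  Thus [a] and [a * c^*] generate the same right ideal,
    and likewise [c] and [c * a^*], which gives the last two conclusions. *)
Lemma left_quotient_eq_witness a b c d x y :
  a * a^* = b * b^* -> c * c^* = d * d^* -> a^* * b = c^* * d ->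
  x * x^* = y * y^* -> a * c^* = x^* * y ->
  [/\ x * a = y * c, x * b = y * d, x^* * x * a = a & y^* * y * c = c].
Proof.
move=> aRb cRd abE xRy acE.
have aLc : a^* * a = c^* * c.
  by rewrite -(left_quotient_mulV aRb) abE (left_quotient_mulV cRd).
have caE : c * a^* = y^* * x by rewrite -[c]sginvK -sginvM acE sginvM sginvK.
have [xaE _ xac] := right_quotient_common_multiple xRy acE.
have [_ _ yca] := right_quotient_common_multiple (esym xRy) caE.
split=> //.
- rewrite -[in LHS](mulgVg b) -aRb -mulgA abE (mulgA x) xaE.
  by rewrite -!mulgA (mulgA c) cRd mulgVg.
- by rewrite -[in LHS](mulgVg a) -(mulgA a) aLc (mulgA a) (mulgA _ (a * _)) xac
    -mulgA -aLc mulgA mulgVg.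
- by rewrite -[in LHS](mulgVg c) -(mulgA c) -aLc (mulgA c) (mulgA _ (c * _)) yca
    -mulgA aLc mulgA mulgVg.
Qed.

Lemma left_quotient_eqI a b c d x y :
  x * a = y * c -> x * b = y * d -> x^* * x * a = a -> y^* * y * c = c ->
  a^* * b = c^* * d.
Proof.
move=> xaE xbE xa yc.
rewrite -xa -yc !sginvM !sginvK !mulgA.
by rewrite -sginvM -(mulgA _ x b) xaE xbE sginvM !mulgA.
Qed.

End InverseSemigroupTheory.

(** * Equational forms of the relations *)

Lemma morph_sginv (Q P : inverseSemigroupType) (f : {multiplicative Q -> P})
    (q : Q) :
  f q^* = (f q)^*.
Proof. by apply: sginv_unique; split; rewrite -!gmulfM (mulgVg, mulVgV). Qed.

Lemma relRE (Q : inverseSemigroupType) (S : subsemigroup Q) (a b : S) :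
  relR a b <-> val a * (val a)^* = val b * (val b)^*.
Proof. exact: greenRE. Qed.

Lemma relTE (Q : inverseSemigroupType) (S : subsemigroup Q) (a b c : S) :
  relT a b c <->
  (val c)^* * val c * (val a * (val b)^*) = val a * (val b)^*.
Proof. by rewrite /relT right_mul_set_subE sginvK. Qed.

(** * The lift *)

Section Lift.
Variables (Q P : inverseSemigroupType) (S : subsemigroup Q).
Variables (T : subsemigroup P) (phi : {multiplicative S -> T}).

Lemma lift_quotient (f : {multiplicative Q -> P}) (a b : S) : lifts phi f ->
  f ((val a)^* * val b) = (val (phi a))^* * val (phi b).
Proof. by move=> fphi; rewrite gmulfM morph_sginv !fphi. Qed.

Lemma lift_relR (f : {multiplicative Q -> P}) (a b : S) : lifts phi f ->
  relR a b -> relR (phi a) (phi b).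
Proof.
move=> fphi /relRE ab; apply/relRE.
by rewrite -!fphi -!morph_sginv -!gmulfM ab.
Qed.

Lemma lift_relT (f : {multiplicative Q -> P}) (a b c : S) : lifts phi f ->
  relT a b c -> relT (phi a) (phi b) (phi c).
Proof.
move=> fphi /relTE abc; apply/relTE.
by rewrite -!fphi -!morph_sginv -!gmulfM abc.
Qed.

Hypothesis S_straight : straight S.
Hypothesis phiR : forall a b : S, relR a b -> relR (phi a) (phi b).
Hypothesis phiT :
  forall a b c : S, relT a b c -> relT (phi a) (phi b) (phi c).

Local Notation psi s := (val (phi s)).

Let psiM (s t : S) : psi (s * t) = psi s * psi t.
Proof. by rewrite gmulfM valM. Qed.

Let psi_eqM (x a y c : S) :
  val x * val a = val y * val c -> psi x * psi a = psi y * psi c.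
Proof.
move=> xaE; rewrite -!psiM; suff -> : x * a = y * c by [].
by apply: val_inj; rewrite !valM.
Qed.

Lemma lift_right_quotient (b c x y : S) :
  relR x y -> val b * (val c)^* = (val x)^* * val y ->
  psi b * (psi c)^* = (psi x)^* * psi y.
Proof.
move=> /relRE xRy bcE.
have [xbE yRyc xbc] := right_quotient_common_multiple xRy bcE.
apply: right_quotientI; first exact: psi_eqM.
  by rewrite -psiM; apply/relRE/phiR/relRE; rewrite valM.
by apply/relTE/phiT/relTE.
Qed.

(** As [a * a^* * Q = a * Q], the ternary relation also encodes the inclusion
    [a * Q `<=` x^* * Q]. *)
Let psi_dom (a x : S) :
  (val x)^* * val x * val a = val a -> (psi x)^* * psi x * psi a = psi a.
Proof.
move=> xa; have /phiT/relTE xa' : relT a a x.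
  by apply/relTE; rewrite mulgA xa.
by rewrite -[in LHS](mulgVg (psi a)) mulgA xa' mulgVg.
Qed.

Lemma lift_left_quotient_eq (a b c d : S) :
  relR a b -> relR c d -> (val a)^* * val b = (val c)^* * val d ->
  (psi a)^* * psi b = (psi c)^* * psi d.
Proof.
move=> /relRE aRb /relRE cRd abE.
have [x [y [acE /greenRE xRy]]] := S_straight (val a * (val c)^*).
have [xaE xbE xa yc] := left_quotient_eq_witness aRb cRd abE xRy acE.
by apply: (left_quotient_eqI (x := psi x) (y := psi y));
  solve [exact: psi_eqM | exact: psi_dom].
Qed.

Lemma lift_exists : exists f : {multiplicative Q -> P}, lifts phi f.
Proof.
pose num q := projT1 (cid (projT2 (cid (S_straight q)))).
pose den q := projT1 (cid (S_straight q)).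
have fracP q : q = (val (den q))^* * val (num q) /\ relR (den q) (num q).
  by rewrite /den /num; case: cid => a ab /=; case: cid.
pose f q : P := (psi (den q))^* * psi (num q).
have fE a b : relR a b -> f ((val a)^* * val b) = (psi a)^* * psi b.
  have [qE dRn] := fracP ((val a)^* * val b).
  by move=> aRb; apply: lift_left_quotient_eq.
have fM : {morph f : q r / q * r}.
  move=> q r.
  have [qE /relRE aRb] := fracP q.
  have [rE /relRE cRd] := fracP r.
  rewrite [f q]/f [f r]/f.
  move: (den q) (num q) (den r) (num r) qE aRb rE cRd.
  move=> a b c d -> aRb -> cRd.
  have [x [y [bcE xRy]]] := S_straight (val b * (val c)^*).
  have [xbE yRyc _] :=
    right_quotient_common_multiple (iffLR (greenRE _ _) xRy) bcE.
  have -> : (val a)^* * val b * ((val c)^* * val d) =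
            (val (x * a))^* * val (y * d).
    by rewrite !valM sginvM !mulgA -(mulgA _ (val b)) bcE !mulgA.
  rewrite fE.
    rewrite !psiM sginvM !mulgA -(mulgA _ _^* (psi y)).
    by rewrite -(lift_right_quotient xRy bcE) !mulgA.
  apply/relRE; rewrite !valM !sginvM !mulgA -(mulgA _ (val a)) aRb.
  rewrite -(mulgA _ (val d)) -cRd.
  transitivity (val x * val b * (val x * val b)^*).
    by rewrite sginvM !mulgA.
  by rewrite xbE sginvM !mulgA.
pose F : {multiplicative Q -> P} :=
  HB.pack f (isMultiplicative.Build Q P f fM).
exists F => s; rewrite /F /=.
have [sE /relRE aRb] := fracP (val s); rewrite /f.
move: (den (val s)) (num (val s)) sE aRb => a b sE aRb.
have asE : val a * val s = val b by rewrite sE mulgA aRb mulgVg.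
(* [s] lies in [a^* * Q], hence [psi s] lies in [(psi a)^* * P]. *)
have /psi_dom <- : (val a)^* * val a * val s = val s.
  by rewrite sE !mulgA mulVgV.
have -> : psi b = psi a * psi s.
  rewrite -psiM; suff -> : a * s = b by [].
  by apply: val_inj; rewrite valM asE.
by rewrite mulgA.
Qed.

End Lift.

Theorem theorem2p9 (Q P : inverseSemigroupType) (S : subsemigroup Q)
    (T : subsemigroup P) (phi : {multiplicative S -> T})
    (S_order : left_I_order S) (S_straight : straight S) :
  let conditions :=
    (forall a b : S, relR a b -> relR (phi a) (phi b)) /\
    (forall a b c : S, relT a b c -> relT (phi a) (phi b) (phi c)) in
  [/\ (exists f : {multiplicative Q -> P}, lifts phi f) <-> conditions,
      forall f g : {multiplicative Q -> P},
        lifts phi f -> lifts phi g -> f = g :> (Q -> P)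
    & conditions -> left_I_order (image_subsemigroup phi) ->
      forall f : {multiplicative Q -> P}, lifts phi f ->
        forall p : P, exists q : Q, f q = p].
Proof.
split.
- split=> [[f fphi] | [phiR phiT]]; last exact: lift_exists.
  by split=> [a b | a b c]; [exact: lift_relR | exact: lift_relT].
- move=> f g fphi gphi; apply/funext => q.
  by have [a [b ->]] := S_order q; rewrite (lift_quotient _ _ fphi) (lift_quotient _ _ gphi).
- move=> _ image_order f fphi p.
  have [a [b ->]] := image_order p.
  have [s _ <-] := set_valP a; have [t _ <-] := set_valP b.
  by exists ((val s)^* * val t); rewrite (lift_quotient _ _ fphi).
Qed.
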